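(* Let $G$ be a finite undirected graph (possibly with loops and multiple edges) with nonempty vertex set $V$ and edge set $E$, and let $b\in\mathbb{R}^V$ be nonzero with all entries nonnegative. Let $H$ be a spanning subgraph of $G$. Then the following are equivalent: (i) $H$ is a graph of $\mathcal{P}(G,b)$, i.e. $H\in\mathcal{G}(G,b)$; (ii) $H$ is the graph of a subset of $\mathcal{P}(G,b)$; (iii) $H$ is the graph of an element of $\mathcal{P}(G,b)$, or $H$ has no edges; (iv) $H$ is the graph of a face of $\mathcal{P}(G,b)$; (v) $H$ is a union of graphs of vertices of $\mathcal{P}(G,b)$; (vi) $H$ is the union of the graphs of all vertices of $\mathcal{P}(G,b)$ whose graph is contained in $H$; (vii) $H$ has no edges, or else: $\sum_{v\in V_1}b_v\ge\sum_{v\in V_3}b_v$ for all pairwise disjoint (possibly empty) sets $V_1,V_2,V_3$ such that $V=V_1\cup V_2\cup V_3$ and $H[V_2\cup V_3,V_3]=\emptyset$, with the inequality holding as an equality if and only if $H[V_1,V_1\cup V_2]=\emptyset$.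
   Context: $\delta_G(v)$ denotes the set of edges of $G$ incident with $v$; a loop at $v$ appears once in $\delta_G(v)$. $\mathcal{P}(G,b)=\{x\in\mathbb{R}^E \mid x_e\ge 0 \text{ for each } e\in E,\ \sum_{e\in\delta_G(v)}x_e=b_v \text{ for each } v\in V\}$ (a polytope; empty when $E=\emptyset$, since $b\ne0$). The faces of a polytope include $\emptyset$ and the polytope itself. A spanning subgraph of $G$ is a subgraph with vertex set $V$. For $X\subset\mathcal{P}(G,b)$, the graph $\mathrm{gr}(X)$ of $X$ is the spanning subgraph of $G$ with edge set $\{e\in E\mid \text{there exists } x\in X\text{ with }x_e>0\}$, and the graph of an element $x$ is $\mathrm{gr}(x)=\mathrm{gr}(\{x\})$. $\mathcal{G}(G,b)=\{\mathrm{gr}(X)\mid X\subset\mathcal{P}(G,b)\}$, whose elements are called the graphs of $\mathcal{P}(G,b)$. Union and containment of spanning subgraphs of $G$ mean union and containment of their edge sets; an empty union is the spanning subgraph with no edges. For $U,W\subset V$, $H[U,W]$ is the set of all edges of $H$ whose endpoints are $u$ and $w$ for some $u\in U$ and $w\in W$ (a loop at $v$ has both endpoints equal to $v$). *)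

(* Defs.v *)
From mathcomp Require Import all_boot all_order all_algebra.
From mathcomp Require Import boolp classical_sets reals.

Set Implicit Arguments.
Unset Strict Implicit.
Unset Printing Implicit Defensive.

Import Order.TTheory GRing.Theory Num.Theory.

Local Open Scope classical_set_scope.
Local Open Scope ring_scope.

(* A finite undirected graph, loops and parallel edges allowed: each edge
   carries the set of its endpoints, which is a singleton exactly for loops. *)
Record multigraph := Multigraph {
  vertices : finType;
  edges : finType;
  ends : edges -> {set vertices};
  ends_card : forall e, (0 < #|ends e| <= 2)%N }.

(* A spanning subgraph is determined by its edge set. Hence inclusion, union
   and emptiness of spanning subgraphs are those of sets of edges. *)
Definition spanning_subgraph (G : multigraph) : Type := set (edges G).

(* A loop at v is counted once, as e ranges over edges, not half-edges. *)
Definition delta (G : multigraph) (v : vertices G) : {set edges G} :=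
  [set e | v \in ends e]%SET.

Definition edges_between (G : multigraph) (H : spanning_subgraph G)
    (U W : {set vertices G}) : set (edges G) :=
  [set e | H e /\ exists u w, [/\ u \in U, w \in W & ends e = [set u; w]%SET]].

Definition polytope (R : realType) (G : multigraph)
    (b : {ffun vertices G -> R}) : set {ffun edges G -> R} :=
  [set x | (forall e, 0 <= x e) /\
           (forall v, \sum_(e in delta v) x e = b v)].

(* The normal vector c may be 0, so that set0 (c = 0, d = 1) and P itself
   (c = 0, d = 0) are faces of P. *)
Definition face (R : realType) (I : finType) (P F : set {ffun I -> R}) : Prop :=
  exists (c : {ffun I -> R}) (d : R),
    (forall x, P x -> \sum_i c i * x i <= d) /\
    F = [set x | P x /\ \sum_i c i * x i = d].

(* Vertices are the zero-dimensional faces. *)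
Definition vertex (R : realType) (I : finType) (P : set {ffun I -> R})
    (x : {ffun I -> R}) : Prop :=
  face P [set x].

Definition gr (R : realType) (G : multigraph) (X : set {ffun edges G -> R}) :
    spanning_subgraph G :=
  [set e | exists2 x, X x & 0 < x e].

Definition graphs (R : realType) (G : multigraph)
    (b : {ffun vertices G -> R}) : set (spanning_subgraph G) :=
  [set gr X | X in [set X | X `<=` polytope b]].

(* Main.v *)
(* Averaging turns a set of points of the polytope into a single point with the
   same graph.  If x_e > 0, then among the points y with supp y contained in
   supp x and y_e > 0, one of minimal support is a vertex: it is the only point
   of the face cut out by its support.  By Motzkin's transposition theorem, H is
   the graph of a point iff every y in R^V whose sum over the ends of each edge
   of H is nonnegative satisfies b.y >= 0, with equality only if all these sums
   vanish.  Such a y is a nonnegative combination of {-1,0,1}-valued ones, and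
   these are the tripartitions (V1, V2, V3) = ({y = 1}, {y = 0}, {y = -1}). *)

Require Import Defs.
From mathcomp Require Import all_boot all_order all_algebra.
From mathcomp Require Import boolp classical_sets reals.
From mathcomp Require Import lra.

Set Implicit Arguments.
Unset Strict Implicit.
Unset Printing Implicit Defensive.

Import Order.TTheory GRing.Theory Num.Theory.

Local Open Scope classical_set_scope.
Local Open Scope ring_scope.

(** * Farkas' lemma and strictly positive solutions *)

(** Induction on the number of generators. If the hypothesis fails without [a k], a witness [z0] of
    the failure pairs negatively with [a k], and projecting along it eliminates [a k]. *)
Lemma farkas (R : realFieldType) (I V : finType) (J : {set I})
    (a : I -> V -> R) (g : V -> R) :
  (forall y : V -> R, (forall i, i \in J -> 0 <= \sum_v a i v * y v) ->
     0 <= \sum_v g v * y v) ->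
  exists2 x : I -> R, forall i, 0 <= x i &
    forall v, g v = \sum_(i in J) x i * a i v.
Proof.
elim: {J}#|J| {-2}J (erefl #|J|) a g => [|n IHn] J cardJ a g gP.
  exists (fun=> 0) => // v; rewrite (cards0_eq cardJ) big_set0.
  (* Without generators, testing against [- g] forces the sum of squares of [g] to be 0. *)
  have := gP (fun w => - g w).
  rewrite (cards0_eq cardJ) => /(_ (fun i => ltac:(by rewrite inE))).
  under eq_bigr do rewrite mulrN -expr2.
  rewrite sumrN oppr_ge0 => sg_le0.
  apply/eqP; rewrite -sqrf_eq0; move: (sqr_ge0 (g v)); rewrite le_eqVlt.
  case/orP=> [/eqP <- //|gv_gt0]; move: sg_le0; rewrite leNgt => /negP[].
  by rewrite (bigD1 v) //= ltr_wpDr // sumr_ge0 // => w _; exact: sqr_ge0.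
have /set0Pn[k kJ] : J != finset.set0 by rewrite -card_gt0 cardJ.
have cardJk : #|(J :\ k)%SET| = n.
  by move: cardJ; rewrite (cardsD1 k) kJ add1n => -[].
have [gP'|] := pselect (forall y : V -> R,
    (forall i, i \in (J :\ k)%SET -> 0 <= \sum_v a i v * y v) ->
    0 <= \sum_v g v * y v).
  have [x x_ge0 xE] := IHn _ cardJk a g gP'.
  exists (fun i => if i == k then 0 else x i) => [i|v]; first by case: ifP.
  rewrite (big_setD1 k) //= eqxx mul0r add0r xE.
  by apply: eq_bigr => i; rewrite in_setD1 => /andP[/negPf ->].
move=> /existsNP[z0 /not_implyP[az0 /negP]]; rewrite -ltNge => gz0.
have akz0 : \sum_v a k v * z0 v < 0.
  rewrite ltNge; apply/negP => akz0; move: gz0; rewrite ltNge => /negP; apply.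
  apply: gP => i iJ; have [->//|ik] := eqVneq i k.
  by apply: az0; rewrite in_setD1 ik.
pose t := (- \sum_v a k v * z0 v)^-1.
have t_gt0 : 0 < t by rewrite invr_gt0 oppr_gt0.
pose z v := t * z0 v.
have dotz (h : V -> R) : \sum_v h v * z v = t * \sum_v h v * z0 v.
  by rewrite mulr_sumr; apply: eq_bigr => v _; rewrite mulrCA.
have akz : \sum_v a k v * z v = -1.
  by rewrite dotz /t invrN mulNr mulVf // lt_eqF.
have az i : i \in (J :\ k)%SET -> 0 <= \sum_v a i v * z v.
  by move=> iJ; rewrite dotz mulr_ge0 ?az0 // ltW.
have gz : \sum_v g v * z v <= 0 by rewrite dotz pmulr_rle0 // ltW.
(* [pi] is the transpose of the projection onto the hyperplane
   orthogonal to [a k] along [z]. *)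
pose pi (h : V -> R) v := h v + (\sum_w h w * z w) * a k v.
have piE h y : \sum_v pi h v * y v =
    \sum_v h v * (y v + (\sum_w a k w * y w) * z v).
  under eq_bigr do rewrite mulrDl -mulrA.
  rewrite big_split /= -mulr_sumr.
  under [RHS]eq_bigr do rewrite mulrDr mulrCA.
  by rewrite big_split /= -mulr_sumr [X in _ + X]mulrC.
have [x x_ge0 xE] : exists2 x : I -> R, forall i, 0 <= x i &
    forall v, pi g v = \sum_(i in (J :\ k)%SET) x i * pi (a i) v.
  apply: (IHn _ cardJk (fun i => pi (a i)) (pi g)) => y ay.
  rewrite piE; apply: gP => i iJ; have [->|ik] := eqVneq i k.
    under eq_bigr do rewrite mulrDr mulrCA.
    by rewrite big_split /= -mulr_sumr akz mulrN1 subrr.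
  by rewrite -piE ay // in_setD1 ik.
(* The coefficient of [a k] left over when the projections in [xE] are expanded; it is nonnegative
   since [z] pairs nonnegatively with the other generators and nonpositively with [g]. *)
pose xk := \sum_(i in (J :\ k)%SET) x i * (\sum_w a i w * z w)
           - \sum_w g w * z w.
exists (fun i => if i == k then xk else x i) => [i|v].
  case: ifP => // _; rewrite addr_ge0 ?oppr_ge0 // sumr_ge0 // => j jJ.
  by rewrite mulr_ge0 // az.
rewrite (big_setD1 k) //= eqxx mulrBl mulr_suml.
transitivity (pi g v - (\sum_w g w * z w) * a k v); first by rewrite addrK.
rewrite xE addrAC -big_split /=; congr (_ - _); apply: eq_bigr => i.
by rewrite in_setD1 => /andP[/negPf -> _]; rewrite mulrDr mulrA addrC.
Qed.

(* Motzkin's variant of Farkas' lemma: a strictly positive solution exists as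
   soon as each coordinate can be made positive separately, and the latter is
   Farkas' lemma for the target [- a e] and the additional generator [- b]. *)
Lemma positive_solution (R : realFieldType) (I V : finType) (J : {set I})
    (a : I -> V -> R) (b : V -> R) :
  (forall y : V -> R, (forall i, i \in J -> 0 <= \sum_v a i v * y v) ->
     0 <= \sum_v b v * y v /\
     (\sum_v b v * y v = 0 -> forall i, i \in J -> \sum_v a i v * y v = 0)) ->
  exists2 x : I -> R, forall i, i \in J -> 0 < x i &
    forall v, b v = \sum_(i in J) x i * a i v.
Proof.
move=> bP.
have [x0 x0_ge0 x0E] := farkas (fun y ay => (bP y ay).1).
have solve e : exists x : I -> R, [/\ forall i, 0 <= x i, e \in J -> 0 < x e &
    forall v, b v = \sum_(i in J) x i * a i v].
  have [eJ|eJ] := boolP (e \in J); last by exists x0; split.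
  pose a' (o : option I) := if o is Some i then a i else fun v => - b v.
  pose J' := [set o : option I | if o is Some i then i \in J else true]%SET.
  have [x x_ge0 xE] : exists2 x : option I -> R, forall i, 0 <= x i &
      forall v, - a e v = \sum_(i in J') x i * a' i v.
    apply: farkas => y ay.
    have aJ i : i \in J -> 0 <= \sum_v a i v * y v.
      by move=> iJ; apply: (ay (Some i)); rewrite inE.
    have by_le0 : \sum_v b v * y v <= 0.
      have := ay None; rewrite inE => /(_ isT) /=.
      by under eq_bigr do rewrite mulNr; rewrite sumrN oppr_ge0.
    (* The product of [b] and [y] is bounded by 0 on both sides, so [a e] vanishes on [y]. *)
    have [by_ge0 by0] := bP y aJ.
    under eq_bigr do rewrite mulNr.
    by rewrite sumrN by0 ?oppr0 //; apply/le_anti/andP.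
  have xE' v : - a e v = \sum_(i in J) x (Some i) * a i v - x None * b v.
    rewrite xE (big_setD1 None) ?inE //= mulrN addrC; congr (_ - _).
    rewrite (reindex_omap Some id) /=; last by case; rewrite ?inE.
    by apply: eq_bigl => i; rewrite !inE eqxx andbT.
  have t_gt0 : 0 < 1 + x None by rewrite ltr_pwDl.
  (* Solving [xE'] for [x None * b v] and adding [x0E] expresses [(1 + x None) * b v] with a
     coefficient at least 1 at [e]. *)
  exists (fun i => (1 + x None)^-1 * (x0 i + (x (Some i) + (i == e)%:R))).
  split=> [i||v]; first by rewrite mulr_ge0 ?invr_ge0 ?(ltW t_gt0) ?addr_ge0.
    by move=> _; rewrite mulr_gt0 ?invr_gt0 // eqxx ltr_wpDl // ltr_wpDl.
  have aE : \sum_(i in J) (i == e)%:R * a i v = a e v.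
    rewrite (bigD1 e) //= eqxx mul1r big1 ?addr0 // => i /andP[_ /negPf ->].
    by rewrite mul0r.
  under eq_bigr do rewrite -mulrA mulrDl [X in _ * (_ + X)]mulrDl.
  rewrite -mulr_sumr !big_split /= -x0E aE.
  have -> : \sum_(i in J) x (Some i) * a i v = x None * b v - a e v.
    by rewrite xE' subrKC.
  by rewrite subrK -{2}[b v]mul1r -mulrDl mulKf // gt_eqF.
have [x xP] := choice solve.
have x_ge0 i j : 0 <= x i j by have [] := xP i.
(* The successor counts [x0], which is averaged with the solutions [x e]; so [m] is nonzero even for
   empty [I]. *)
pose m : R := #|I|.+1%:R.
have m_gt0 : 0 < m by rewrite ltr0n.
exists (fun i => m^-1 * (x0 i + \sum_e x e i)) => [i iJ|v].
  rewrite mulr_gt0 ?invr_gt0 // ltr_wpDl // (bigD1 i) //= ltr_pwDl ?sumr_ge0 //.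
  by have [_ ->] := xP i.
under eq_bigr do rewrite -mulrA mulrDl big_distrl /=.
rewrite -mulr_sumr big_split /= -x0E exchange_big /=.
rewrite (eq_bigr (fun=> b v)) => [|e _]; last by have [] := xP e.
by rewrite sumr_const -mulrS -[_ *+ _]mulr_natl mulKf // gt_eqF.
Qed.

(** * Supports, faces and vertices of the polytope *)

Section Polytope.
Context {R : realType} {G : multigraph}.
Implicit Types (b : {ffun vertices G -> R}) (x y z : {ffun edges G -> R}).

(** The transposed incidence matrix applied to [y]; a loop at [v] contributes [y v] once, in
    accordance with [delta]. *)
Definition edge_sum (y : vertices G -> R) (e : edges G) :=
  \sum_(v in ends e) y v.

Lemma polytope_dot b x (y : vertices G -> R) : polytope b x ->
  \sum_v b v * y v = \sum_e x e * edge_sum y e.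
Proof.
move=> [_ xb]; under eq_bigr => v _ do rewrite -xb big_distrl /=.
rewrite (exchange_big_dep predT) //=; apply: eq_bigr => e _.
by rewrite mulr_sumr; apply: eq_bigl => v; rewrite inE.
Qed.

(** Every edge has an end, and strict inequality on the edge would make the sums at that end differ,
    although both equal [b]. *)
Lemma polytope_le_eq b x y :
  polytope b x -> polytope b y -> (forall e, x e <= y e) -> x = y.
Proof.
move=> [_ xb] [_ yb] lexy; apply/ffunP => e.
have /card_gt0P[v ve] : (0 < #|ends e|)%N by case/andP: (ends_card e).
have ev : e \in delta v by rewrite inE.
apply/eqP; rewrite eq_le lexy /= leNgt; apply/negP => ltxy.
have : \sum_(f in delta v) x f < \sum_(f in delta v) y f.
  rewrite (bigD1 e) //= [ltRHS](bigD1 e) //=.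
  by apply: ltr_leD => //; apply: ler_sum.
by rewrite xb yb ltxx.
Qed.

Lemma support_face b (H : set (edges G)) :
  face (polytope b) [set y | polytope b y /\ forall e, ~ H e -> y e = 0].
Proof.
(* Minus the indicator of the complement of [H]: on the polytope its product with a point is at most
   0, with equality when all coordinates outside [H] vanish and only then. *)
exists [ffun e => - (`[< ~ H e >])%:R], 0; split.
  move=> x [x_ge0 _]; apply: sumr_le0 => e _.
  by rewrite ffunE mulNr oppr_le0 mulr_ge0.
apply/seteqP; split=> y /= [Py yH]; split=> //.
  apply: big1 => e _; rewrite ffunE; case: asboolP => [/yH ->|_].
    by rewrite mulr0.
  by rewrite oppr0 mul0r.
move=> e He; move/eqP: yH.
under eq_bigr do rewrite ffunE mulNr.
rewrite sumrN oppr_eq0 psumr_eq0 => [/allP/(_ e)|f _]; last first.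
  by rewrite mulr_ge0 //; case: Py.
by rewrite mem_index_enum asboolT // mul1r => /(_ isT)/eqP.
Qed.

(** Leave [x] along [z - x] or [x - z], whichever does not decrease coordinate [e], until a first
    coordinate reaches 0. *)
Lemma polytope_move b x z e : polytope b x -> polytope b z -> x <> z ->
    (forall f, x f = 0 -> z f = 0) -> 0 < x e ->
  exists y, [/\ polytope b y, forall f, x f = 0 -> y f = 0, 0 < y e &
    exists2 f, x f != 0 & y f = 0].
Proof.
move=> Px Pz xz zx xe_gt0.
have [d [d0 dx de [k dk]]] : exists d : edges G -> R,
    [/\ forall v, \sum_(f in delta v) d f = 0,
        forall f, x f = 0 -> d f = 0, 0 <= d e & exists f, d f < 0].
  have sumB (p q : {ffun edges G -> R}) v : polytope b p -> polytope b q ->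
      \sum_(f in delta v) (p f - q f) = 0.
    by move=> [_ pb] [_ qb]; rewrite sumrB pb qb subrr.
  (* Either direction decreases some coordinate, as distinct points of the polytope are
     incomparable. *)
  have lt_ex p q : polytope b p -> polytope b q -> p <> q ->
      exists f, p f - q f < 0.
    move=> Pp Pq pq; apply: contrapT => /forallNP npq; apply: pq; apply/esym.
    apply: (polytope_le_eq Pq Pp) => f.
    by rewrite leNgt -subr_lt0; apply/negP/npq.
  have [le_xz|/ltW le_zx] := leP (x e) (z e).
    exists (fun f => z f - x f); split=> [v|f xf||]; rewrite ?subr_ge0 //.
    - exact: sumB.
    - by rewrite xf zx ?subrr.
    - by apply: lt_ex => // /esym.
  exists (fun f => x f - z f); split=> [v|f xf||]; rewrite ?subr_ge0 //.
  - exact: sumB.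
  - by rewrite xf zx ?subrr.
  - exact: lt_ex.
have [x_ge0 xb] := Px.
(* Ratio test: the least ratio over the decreasing coordinates is the longest step that keeps all
   coordinates nonnegative, and its minimizer [f] drops to 0. *)
have [f /= df fmin] :=
  @arg_minP _ R _ k [pred f | d f < 0] (fun f => x f / - d f) dk.
pose t := x f / - d f.
have t_ge0 : 0 <= t by rewrite divr_ge0 // oppr_ge0 ltW.
exists [ffun g => x g + t * d g]; split.
- split=> [g|v].
    rewrite ffunE; have [dg|dg] := leP 0 (d g).
      by rewrite addr_ge0 // mulr_ge0.
    have := fmin g dg; rewrite -/t ler_pdivlMr ?oppr_gt0 //.
    by rewrite mulrN -subr_ge0 opprK.
  under eq_bigr do rewrite ffunE.
  by rewrite big_split /= -mulr_sumr d0 mulr0 addr0.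
- by move=> g xg; rewrite ffunE xg dx // mulr0 addr0.
- by rewrite ffunE ltr_wpDr // mulr_ge0.
exists f; first by apply: contraTN df => /eqP/dx ->; rewrite ltxx.
by rewrite ffunE /t invrN mulrN mulNr divfK ?subrr // lt_eqF.
Qed.

Lemma vertex_polytope b x : vertex (polytope b) x -> polytope b x.
Proof.
case=> c [d [_ /seteqP[/(_ x erefl) /= [Px _] _]]]; exact: Px.
Qed.

(** Descent on the size of the support by [polytope_move]; it stops when [x] is alone in its support
    face. *)
Lemma polytope_vertex_support b x e : polytope b x -> 0 < x e ->
  exists v, [/\ vertex (polytope b) v, forall f, x f = 0 -> v f = 0 & 0 < v e].
Proof.
elim: {x}#|[set f | x f != 0]%SET| {-2}x (leqnn #|[set f | x f != 0]%SET|)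
    => [|n IHn] x cardx Px xe_gt0.
  move: cardx; rewrite leqn0 => /eqP/cards0_eq/setP/(_ e).
  by rewrite !inE gt_eqF.
have [[z [Pz xz zx]]|noz] := pselect (exists z,
    [/\ polytope b z, x <> z & forall f, x f = 0 -> z f = 0]).
  have [y [Py yx ye [f xf yf]]] := polytope_move Px Pz xz zx xe_gt0.
  have [|v [Vv vy ve]] := IHn y _ Py ye; last first.
    by exists v; split=> // g /yx/vy.
  rewrite -ltnS; apply: leq_trans cardx; apply: proper_card.
  apply/properP; split; last by exists f; rewrite inE // yf eqxx.
  by apply/fintype.subsetP => g; rewrite !inE; apply: contraNN => /eqP/yx ->.
exists x; split=> //; rewrite /vertex.
have -> : [set x] = [set y | polytope b y /\ forall f, ~ (x f != 0) -> y f = 0].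
  apply/seteqP; split=> y /= => [->|[Py yx]].
    by split=> // f /negP; rewrite negbK => /eqP.
  apply: contrapT => /nesym xy; apply: noz; exists y; split=> // f xf.
  by apply: yx; rewrite xf eqxx.
exact: support_face.
Qed.

(** * Graphs of sets of points *)

(** Average one point of [X] per edge. The case without edges is separate because [X] may be empty,
    leaving nothing to average. *)
Lemma gr_element b (X : set {ffun edges G -> R}) : X `<=` polytope b ->
  (exists2 x, polytope b x & gr X = gr [set x]) \/ gr X = set0.
Proof.
move=> XP; have [->|/set0P[e0 He0]] := eqVneq (gr X) set0; [by right|left].
(* An edge outside [gr X] receives a default point of [X], namely the one witnessing [e0]. *)
have : forall e, exists y, X y /\ (gr X e -> 0 < y e).
  move=> e; have [[y Xy ye]|He] := pselect (gr X e); first by exists y.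
  by case: He0 => y Xy _; exists y.
move=> /choice[y yP].
pose m : R := #|edges G|%:R.
have m_gt0 : 0 < m by rewrite ltr0n; apply/card_gt0P; exists e0.
have y_ge0 e f : 0 <= y e f by have [/XP[]] := yP e.
pose x := [ffun f => m^-1 * \sum_e y e f].
exists x.
  split=> [f|v].
    by rewrite ffunE mulr_ge0 ?invr_ge0 ?(ltW m_gt0) ?sumr_ge0.
  under eq_bigr do rewrite ffunE.
  rewrite -mulr_sumr exchange_big /=.
  rewrite (eq_bigr (fun=> b v)) => [|e _]; last by have [/XP[_ ->]] := yP e.
  by rewrite sumr_const -[_ *+ _]mulr_natl mulKf // gt_eqF.
apply/seteqP; split=> e.
  move=> /(yP e).2 ye; exists x => //.
  rewrite ffunE mulr_gt0 ?invr_gt0 // (bigD1 e) //= ltr_pwDl // sumr_ge0 //.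
move=> [_ ->]; rewrite ffunE pmulr_rgt0 ?invr_gt0 // => sum_gt0.
apply: contrapT => He; move: sum_gt0; rewrite big1 ?ltxx // => f _.
have [Xf _] := yP f.
apply/eqP; rewrite eq_le y_ge0 andbT leNgt; apply/negP => yfe.
by apply: He; exists (y f).
Qed.

Lemma bigcup_gr (S : set {ffun edges G -> R}) :
  \bigcup_(x in S) gr [set x] = gr S.
Proof.
apply/seteqP; split=> e; first by move=> [x Sx [_ -> xe]]; exists x.
by move=> [x Sx xe]; exists x => //; exists x.
Qed.

(** * Edge sums of the sign vectors of tripartitions *)

Lemma edge_sum_set2 (y : vertices G -> R) e u w : ends e = [set u; w]%SET ->
  edge_sum y e = if u == w then y u else y u + y w.
Proof.
rewrite /edge_sum => ->; have [->|uw] := eqVneq u w.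
  by rewrite finset.setUid big_set1.
by rewrite big_setU1 ?inE //= big_set1.
Qed.

Lemma ends_set2 (e : edges G) : exists u w, ends e = [set u; w]%SET.
Proof.
case/andP: (ends_card e) => e_gt0.
rewrite leq_eqVlt ltnS => /orP[/cards2P[u [w [_ ->]]]|e_le1].
  by exists u, w.
have /cards1P[u ->] : #|ends e| == 1%N by rewrite eqn_leq e_le1.
by exists u, u; rewrite finset.setUid.
Qed.

(** The ends of an edge are unordered, so a fixed naming [u], [w] is tested both ways round.
    Membership then depends only on the classes of [u] and [w]. *)
Lemma edges_betweenE (H : spanning_subgraph G) (U W : {set vertices G}) e u w :
  ends e = [set u; w]%SET -> edges_between H U W e <->
  H e /\ ((u \in U) && (w \in W) || (w \in U) && (u \in W)).
Proof.
move=> eE; split=> [[He [u' [w' [u'U w'W e'E]]]]|[He /orP[]/andP[uU wW]]].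
- split=> //; move/setP: e'E; rewrite eE => uw.
  have := (uw u, uw w, (uw u', uw w')); rewrite !inE !eqxx /= !orbT.
  move=> [[/esym/orP uE /esym/orP wE] [/orP u'E /orP w'E]].
  by case: uE => /eqP ?; case: wE => /eqP ?; case: u'E => /eqP ?;
    case: w'E => /eqP ?; subst; rewrite ?u'U ?w'W ?orbT.
- by split=> //; exists u, w.
- by split=> //; exists w, u; rewrite eE finset.setUC.
Qed.

Definition signed (V1 V3 : {set vertices G}) v : R :=
  (v \in V1)%:R - (v \in V3)%:R.

Lemma signed_dot b V1 V3 :
  \sum_v b v * signed V1 V3 v = \sum_(v in V1) b v - \sum_(v in V3) b v.
Proof.
have sumE V' : \sum_(v in V') b v = \sum_v b v * (v \in V')%:R.
  rewrite big_mkcond; apply: eq_bigr => v _.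
  by case: ifP => _; rewrite ?mulr1 ?mulr0.
by rewrite !sumE -sumrB; apply: eq_bigr => v _; rewrite -mulrBr.
Qed.

Section Signed.
Variables (H : spanning_subgraph G) (V1 V2 V3 : {set vertices G}).
Hypothesis V12 : (V1 :&: V2)%SET = finset.set0.
Hypothesis V13 : (V1 :&: V3)%SET = finset.set0.
Hypothesis V23 : (V2 :&: V3)%SET = finset.set0.
Hypothesis V123 : [set: vertices G]%SET = (V1 :|: V2 :|: V3)%SET.

(** Case analysis on it settles three membership tests at once, with three cases instead of
    eight. *)
Variant part_spec : bool -> bool -> bool -> Prop :=
  | Part1 : part_spec true false false
  | Part2 : part_spec false true false
  | Part3 : part_spec false false true.

Let partP v : part_spec (v \in V1) (v \in V2) (v \in V3).
Proof.
move/setP/(_ v): V12; move/setP/(_ v): V13; move/setP/(_ v): V23.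
move/setP/(_ v): V123; rewrite !inE.
by case: (v \in V1); case: (v \in V2); case: (v \in V3) => //= _ _ _ _;
  constructor.
Qed.

(** An edge has negative sum exactly when it has an end in [V3] and none in [V1]. *)
Lemma signed_edge_sum_ge0 :
  edges_between H (V2 :|: V3)%SET V3 = set0 <->
  forall e, H e -> 0 <= edge_sum (signed V1 V3) e.
Proof.
split=> [HV e He|es_ge0].
  have [u [w eE]] := ends_set2 e.
  have : ~ edges_between H (V2 :|: V3)%SET V3 e by rewrite HV.
  rewrite (edges_betweenE _ _ _ eE) (edge_sum_set2 _ eE) /signed !inE.
  move=> /not_andP[//|]; case: (eqVneq u w) => [->|_];
  case: (partP u); case: (partP w); rewrite //= => _; lra.
apply/seteqP; split=> // e eV; have [u [w eE]] := ends_set2 e.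
move: eV; rewrite (edges_betweenE _ _ _ eE) => -[/es_ge0].
rewrite (edge_sum_set2 _ eE) /signed !inE; case: (eqVneq u w) => [->|_];
  case: (partP u); case: (partP w);
  rewrite //= => es_e eV; exfalso; move: es_e; lra.
Qed.

(** An edge has positive sum exactly when it has an end in [V1] and none in [V3]; negative sums are
    excluded by the hypothesis. *)
Lemma signed_edge_sum_eq0 :
  edges_between H (V2 :|: V3)%SET V3 = set0 ->
  (edges_between H V1 (V1 :|: V2)%SET = set0 <->
   forall e, H e -> edge_sum (signed V1 V3) e = 0).
Proof.
move=> HV3; split=> [HV e He|es_eq0].
  have [u [w eE]] := ends_set2 e.
  have : ~ edges_between H (V2 :|: V3)%SET V3 e by rewrite HV3.
  have : ~ edges_between H V1 (V1 :|: V2)%SET e by rewrite HV.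
  rewrite !(edges_betweenE _ _ _ eE) (edge_sum_set2 _ eE) /signed !inE.
  move=> /not_andP[//|nV1] /not_andP[//|]; move: nV1.
  case: (eqVneq u w) => [->|_];
  case: (partP u); case: (partP w);
  rewrite //= => _ _; lra.
apply/seteqP; split=> // e eV; have [u [w eE]] := ends_set2 e.
move: eV; rewrite (edges_betweenE _ _ _ eE) => -[/es_eq0].
rewrite (edge_sum_set2 _ eE) /signed !inE; case: (eqVneq u w) => [->|_];
  case: (partP u); case: (partP w);
  rewrite //= => es_e eV; exfalso; move: es_e; lra.
Qed.

End Signed.

Definition tripartition_condition b (H : spanning_subgraph G) :=
  forall V1 V2 V3 : {set vertices G},
    (V1 :&: V2)%SET = finset.set0 ->
    (V1 :&: V3)%SET = finset.set0 ->
    (V2 :&: V3)%SET = finset.set0 ->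
    [set: vertices G]%SET = (V1 :|: V2 :|: V3)%SET ->
    edges_between H (V2 :|: V3)%SET V3 = set0 ->
    \sum_(v in V3) b v <= \sum_(v in V1) b v /\
    (\sum_(v in V1) b v = \sum_(v in V3) b v <->
     edges_between H V1 (V1 :|: V2)%SET = set0).

(** * The tripartition condition and graphs of points *)

(** Complementary slackness: by [polytope_dot] the difference of the two sums of [b] is a sum of
    nonnegative terms, which vanishes only if every edge in the support has sum 0. *)
Lemma gr_tripartition b x :
  polytope b x -> tripartition_condition b (gr [set x]).
Proof.
move=> Px V1 V2 V3 V12 V13 V23 V123 HV3.
have /(_ HV3) s_ge0 := (signed_edge_sum_ge0 (gr [set x]) V12 V13 V23 V123).1.
rewrite (signed_edge_sum_eq0 V12 V13 V23 V123 HV3).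
have x0 e : ~ gr [set x] e -> x e = 0.
  move=> He; apply/eqP; rewrite eq_le Px.1 andbT leNgt; apply/negP => xe.
  by apply: He; exists x.
have xs_ge0 e : 0 <= x e * edge_sum (signed V1 V3) e.
  have [He|/x0 ->] := pselect (gr [set x] e); last by rewrite mul0r.
  by rewrite mulr_ge0 ?s_ge0 ?Px.1.
rewrite -subr_ge0 -signed_dot (polytope_dot _ Px) sumr_ge0 //; split=> //.
split=> [/eqP|s_eq0].
  rewrite -subr_eq0 -signed_dot (polytope_dot _ Px) psumr_eq0 // => /allP s0 e.
  move=> [_ -> xe]; move: (s0 e); rewrite mem_index_enum mulf_eq0 gt_eqF //=.
  by move=> /(_ isT)/eqP.
apply/eqP; rewrite -subr_eq0 -signed_dot (polytope_dot _ Px) big1 // => e _.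
by have [/s_eq0 ->|/x0 ->] := pselect (gr [set x] e); rewrite ?mulr0 ?mul0r.
Qed.

Lemma edge_sumD (y z : vertices G -> R) t e :
  edge_sum (fun v => y v + t * z v) e = edge_sum y e + t * edge_sum z e.
Proof. by rewrite /edge_sum big_split /= mulr_sumr. Qed.

(* Peeling off [t * sg y], where [t] is the least nonzero absolute value of
   [y], writes [y] as a nonnegative combination of feasible sign vectors. *)
Lemma tripartition_dual b (H : spanning_subgraph G) (y : vertices G -> R) :
  tripartition_condition b H -> (forall e, H e -> 0 <= edge_sum y e) ->
  0 <= \sum_v b v * y v /\
  (\sum_v b v * y v = 0 -> forall e, H e -> edge_sum y e = 0).
Proof.
move=> bH.
elim: {y}#|[set v | y v != 0]%SET| {-2}y (leqnn #|[set v | y v != 0]%SET|)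
    => [|n IHn] y cardy y_ge0.
  have y0 v : y v = 0.
    move: cardy; rewrite leqn0 => /eqP/cards0_eq/setP/(_ v).
    by rewrite !inE => /negbFE/eqP.
  split=> [|_ e _]; last by rewrite /edge_sum big1.
  by rewrite big1 // => v _; rewrite y0 mulr0.
have [y0|/existsNP[k /eqP yk]] := pselect (forall v, y v = 0).
  by apply: IHn => //; rewrite eq_card0 // => v; rewrite inE y0 eqxx.
have [m /= ym mmin] :=
  @arg_minP _ R _ k [pred v | y v != 0] (fun v => `|y v|) yk.
pose t := `|y m|.
have t_gt0 : 0 < t by rewrite normr_gt0.
pose V1 := [set v | 0 < y v]%SET; pose V2 := [set v | y v == 0]%SET.
pose V3 := [set v | y v < 0]%SET.
have V12 : (V1 :&: V2)%SET = finset.set0.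
  by apply/setP => v; rewrite !inE; case: ltgtP.
have V13 : (V1 :&: V3)%SET = finset.set0.
  by apply/setP => v; rewrite !inE; case: ltgtP.
have V23 : (V2 :&: V3)%SET = finset.set0.
  by apply/setP => v; rewrite !inE; case: ltgtP.
have V123 : [set: vertices G]%SET = (V1 :|: V2 :|: V3)%SET.
  by apply/setP => v; rewrite !inE; case: ltgtP.
pose s := signed V1 V3.
pose y' v := y v + (- t) * s v.
have t_le v : y v != 0 -> t <= `|y v| by move=> yv; exact: mmin.
(* As [t] is at most every nonzero absolute value, subtracting [t * s v] never carries [y v] past
   0. *)
have y'P v : [\/ [/\ 0 < y v, s v = 1 & 0 <= y' v],
    [/\ y v = 0, s v = 0 & y' v = 0] | [/\ y v < 0, s v = -1 & y' v <= 0]].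
  have := t_le v; rewrite /y' /s /signed !inE.
  case: (ltgtP (y v) 0) => yv.
  - rewrite ltr0_norm // => /(_ isT) t_le_yv.
    by constructor 3; split=> //=; lra.
  - rewrite gtr0_norm // => /(_ isT) t_le_yv.
    by constructor 1; split=> //=; lra.
  by move=> _; constructor 2; split=> //=; lra.
have y'E v : y' v = y v - t * s v by rewrite /y' mulNr.
have s_ge0 e : H e -> 0 <= edge_sum s e.
  move=> /y_ge0; have [u [w eE]] := ends_set2 e.
  rewrite !(edge_sum_set2 _ eE); case: (eqVneq u w) => _;
    case: (y'P u) => -[? ? _]; case: (y'P w) => -[? ? _]; lra.
(* If the ends have opposite signs, the edge sum is unchanged; otherwise neither end is negative,
   and [y'] stays nonnegative there. *)
have y'_ge0 e : H e -> 0 <= edge_sum y' e.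
  move=> /y_ge0; have [u [w eE]] := ends_set2 e.
  have yu := y'E u; have yw := y'E w.
  rewrite !(edge_sum_set2 _ eE); case: (eqVneq u w) => _;
    case: (y'P u) => -[? su ?]; case: (y'P w) => -[? sw ?];
    rewrite su in yu; rewrite sw in yw; lra.
have byE : \sum_v b v * y v = \sum_v b v * y' v + t * \sum_v b v * s v.
  rewrite mulr_sumr -big_split /=; apply: eq_bigr => v _.
  by rewrite y'E mulrBr mulrCA subrK.
have eyE e : edge_sum y e = edge_sum y' e + t * edge_sum s e.
  by rewrite edge_sumD mulNr subrK.
have HV3 := (signed_edge_sum_ge0 H V12 V13 V23 V123).2 s_ge0.
have [] := bH V1 V2 V3 V12 V13 V23 V123 HV3.
rewrite (signed_edge_sum_eq0 V12 V13 V23 V123 HV3) -subr_ge0 -signed_dot -/s.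
move=> bs_ge0 bs_eq0.
have [|by'_ge0 by'_eq0] := IHn y' _ y'_ge0.
  rewrite -ltnS; apply: leq_trans cardy; apply: proper_card.
  apply/properP; split.
    apply/fintype.subsetP => v; rewrite !inE; apply: contraNN => /eqP yv.
    by case: (y'P v) => -[]; rewrite yv ?ltxx // => _ _ ->.
  exists m; rewrite !inE //.
  rewrite y'E /t; case: (y'P m) => -[y_m -> _].
  - by rewrite gtr0_norm // mulr1 subrr eqxx.
  - by rewrite y_m eqxx in ym.
  - by rewrite ltr0_norm // mulrN1 opprK subrr eqxx.
have tbs_ge0 : 0 <= t * \sum_v b v * s v by rewrite mulr_ge0 // ltW.
rewrite byE addr_ge0 //; split=> // by_eq0 e He.
have [by'0 bs0] : \sum_v b v * y' v = 0 /\ \sum_v b v * s v = 0.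
  move/eqP: by_eq0; rewrite paddr_eq0 // mulf_eq0 (gt_eqF t_gt0) /=.
  by move=> /andP[/eqP-> /eqP->].
rewrite eyE by'_eq0 // (bs_eq0.1 _ e He) ?mulr0 ?addr0 //.
by apply/eqP; rewrite -subr_eq0 -signed_dot; apply/eqP.
Qed.

(** A point with graph [H] is a strictly positive solution of the incidence system restricted to
    [H]; [tripartition_dual] is the dual condition that [positive_solution] asks for. *)
Lemma tripartition_gr b (H : spanning_subgraph G) :
  tripartition_condition b H -> exists2 x, polytope b x & H = gr [set x].
Proof.
move=> bH; pose J := [set e | `[< H e >]]%SET.
have dotE (y : vertices G -> R) e :
    \sum_v (v \in ends e)%:R * y v = edge_sum y e.
  rewrite /edge_sum [RHS]big_mkcond; apply: eq_bigr => v _.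
  by case: ifP => _; rewrite ?mul1r ?mul0r.
have [x x_gt0 xE] : exists2 x : edges G -> R, forall e, e \in J -> 0 < x e &
    forall v, b v = \sum_(e in J) x e * (v \in ends e)%:R.
  apply: (positive_solution (a := fun e v => (v \in ends e)%:R)) => y y_ge0.
  have [e He|by_ge0 by_eq0] := @tripartition_dual b H y bH.
    by rewrite -dotE; apply: y_ge0; rewrite inE; apply/asboolP.
  split=> // /by_eq0 y_eq0 e; rewrite inE => /asboolP He.
  by rewrite dotE y_eq0.
pose x' := [ffun e => if e \in J then x e else 0].
have x'_gt0 e : (0 < x' e) = (e \in J).
  by rewrite ffunE; case: ifP => [/x_gt0 //|]; rewrite ltxx.
exists x'.
  split=> [e|v].
    by rewrite ffunE; case: ifP => // /x_gt0/ltW.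
  rewrite xE big_mkcond [RHS]big_mkcond; apply: eq_bigr => e _.
  rewrite /delta finset.in_set ffunE.
  by case: (v \in _); case: (e \in J); rewrite ?mulr1 ?mulr0.
apply/seteqP; split=> e.
  by move=> He; exists x' => //; rewrite x'_gt0 inE; apply/asboolP.
by move=> [_ ->]; rewrite x'_gt0 inE => /asboolP.
Qed.

End Polytope.

(** * The cycle of implications *)

Theorem theorem34 (R : realType) (G : multigraph)
    (hV : (0 < #|vertices G|)%N)
    (b : {ffun vertices G -> R}) (b_neq0 : b != 0)
    (b_ge0 : forall v, 0 <= b v)
    (H : spanning_subgraph G) :
  [<-> graphs b H;
       exists2 X, X `<=` polytope b & H = gr X;
       (exists2 x, polytope b x & H = gr [set x]) \/ H = set0;
       exists2 F, face (polytope b) F & H = gr F;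
       exists2 S, S `<=` vertex (polytope b) &
                  H = \bigcup_(x in S) gr [set x];
       H = \bigcup_(x in [set x | vertex (polytope b) x /\ gr [set x] `<=` H])
             gr [set x];
       H = set0 \/
       forall V1 V2 V3 : {set vertices G},
         (V1 :&: V2)%SET = finset.set0 ->
         (V1 :&: V3)%SET = finset.set0 ->
         (V2 :&: V3)%SET = finset.set0 ->
         [set: vertices G]%SET = (V1 :|: V2 :|: V3)%SET ->
         edges_between H (V2 :|: V3)%SET V3 = set0 ->
         \sum_(v in V3) b v <= \sum_(v in V1) b v /\
         (\sum_(v in V1) b v = \sum_(v in V3) b v <->
          edges_between H V1 (V1 :|: V2)%SET = set0)].
Proof.
tfae.
- by move=> [X XP <-]; exists X.
- by move=> [X XP ->]; exact: gr_element.
- move=> [[x Px ->]|->]; last first.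
    exists set0; last by apply/seteqP; split=> // e [].
    (* The empty face: normal vector 0 with right-hand side 1. *)
    exists [ffun=> 0], 1; split=> [x _|].
      by rewrite big1 // => e _; rewrite ffunE mul0r.
    apply/seteqP; split=> // x [_].
    rewrite big1 => [/esym/eqP|e _]; first by rewrite oner_eq0.
    by rewrite ffunE mul0r.
  eexists; first exact: (support_face b (gr [set x])).
  apply/seteqP; split=> e.
    move=> [_ -> xe]; exists x => //; split=> // f Hf.
    apply/eqP; rewrite eq_le Px.1 andbT leNgt; apply/negP => xf.
    by apply: Hf; exists x.
  move=> [y [_ yH] ye]; apply: contrapT => /yH y0.
  by rewrite y0 ltxx in ye.
- move=> [F [c [d [_ FE]]] ->].
  (* Selecting vertices by their graph, not by membership in [F], uses only that [F] lies in the
     polytope. *)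
  exists [set v | vertex (polytope b) v /\ gr [set v] `<=` gr F].
    by move=> v [].
  rewrite bigcup_gr; apply/seteqP; split=> e; last first.
    by move=> [v [_ vF] ve]; apply: vF; exists v.
  move=> [x Fx xe]; have Px : polytope b x by move: Fx; rewrite FE => -[].
  have [v [Vv vx ve]] := polytope_vertex_support Px xe.
  exists v => //; split=> // f [_ -> vf]; exists x => //.
  rewrite lt_neqAle Px.1 andbT eq_sym; apply/eqP => /vx vf0.
  by rewrite vf0 ltxx in vf.
- move=> [S SV HE]; apply/seteqP; split=> e.
    rewrite {1}HE => -[x Sx xe]; exists x => //; split; first exact: SV.
    by rewrite HE => f xf; exists x.
  by move=> [x [_ xH] /xH].
(* The union is the graph of the set of these vertices, hence by averaging the graph of one point or
   empty. *)
- rewrite bigcup_gr => HE.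
  have [x []|[x Px]|] := @gr_element _ _ b
    [set x | vertex (polytope b) x /\ gr [set x] `<=` H].
  + by move=> /vertex_polytope.
  + by rewrite -HE => ->; right; exact: gr_tripartition.
  + by rewrite -HE; left.
- move=> [->|/tripartition_gr[x Px ->]].
    by exists set0 => //; apply/seteqP; split=> // e [].
  by exists [set x] => // _ ->.
Qed.
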